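(* Let $n,m\in\mathbb N$, let $A\subset\mathbb R^n$ be open, connected and unbounded, let $X$ be a compact metric space, let $\kappa:\overline A\to X$ be a compactification, and let $\varphi\in\mathcal C^m(\overline A,\mathbb R^+)$. Then $\mathcal C^m_{\kappa,\varphi}(\overline A)$ is a Banach space with the norm $$\|f\|_{\kappa,\varphi}:=\|f/\varphi\|_m,\qquad f\in\mathcal C^m_{\kappa,\varphi}(\overline A).$$ In fact, $\mathcal C^m_{\kappa,\varphi}(\overline A)$ is isometrically isomorphic to a closed subspace of $\mathcal{BC}^m(\overline A)$.
   Context: $\mathbb R^+=(0,\infty)$. A continuous map $\kappa:S\to Y$ from a topological space $S$ to a compact topological space $Y$ is a compactification of $S$ if $\kappa(S)$ is dense in $Y$ and $\kappa:S\to\kappa(S)$ is a homeomorphism. For a compactification $\kappa:S\to Y$, a function $g:S\to Z$ with $Z$ Hausdorff, and $y\in Y\setminus\kappa(S)$, one writes $\lim_{x\to y}^{\kappa}g(x)=z$ if for every neighborhood $V$ of $z$ in $Z$ there is a neighborhood $U$ of $y$ in $Y$ with $g(\kappa^{-1}(U\setminus\{y\}))\subset V$. For a multi-index $p=(p_1,\dots,p_n)\in(\{0\}\cup\mathbb N)^n$, $|p|=\sum_j p_j$ and $\partial_p=\partial^{|p|}/\partial x_1^{p_1}\cdots\partial x_n^{p_n}$; $P_m=\{p\in(\{0\}\cup\mathbb N)^n: |p|\le m\}$. $\mathcal C^m(\overline A,\cdot)$ denotes $m$-times continuously differentiable functions on $\overline A$. Define $$\mathcal C^m_{\kappa,\varphi}(\overline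 A)=\left\{f\in\mathcal C^m(\overline A,\mathbb R):\ \lim_{y\to x}{}^{\kappa}\,\partial_p(f/\varphi)(y)\text{ exists in }\mathbb R\text{ for all }x\in X\setminus\kappa(\overline A),\ p\in P_m\right\}.$$ $\mathcal{BC}^m(\overline A)$ is the Banach space of $m$-times continuously differentiable real functions $f$ on $\overline A$ that are bounded together with their partial derivatives up to order $m$, with the norm $\|f\|_m=\max\{\|\partial_pf\|_\infty:\ p\in P_m\}$. *)

(* Defs.v *)
From HB Require Import structures.
From mathcomp Require Import all_boot all_order all_algebra.
From mathcomp Require Import all_classical all_reals all_analysis.

Set Implicit Arguments.
Unset Strict Implicit.
Unset Printing Implicit Defensive.

Import Order.TTheory GRing.Theory Num.Theory.
Import numFieldNormedType.Exports.

Local Open Scope classical_set_scope.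
Local Open Scope ring_scope.

(* Functions on the closure of [A] are functions on the subtype [closure A],
   which carries the topology induced by 'rV[R]_n. *)

Section compactification.

(* [kappa] is a homeomorphism onto its image: it has a left inverse [g] whose
   restriction to the subspace [range kappa] is continuous. *)
Definition compactification (S Y : topologicalType) (kappa : S -> Y) : Prop :=
  [/\ compact [set: Y], continuous kappa, dense (range kappa) &
      exists g : Y -> S,
        {within range kappa, continuous g} /\ cancel kappa g].

Definition klim (S Y Z : topologicalType) (kappa : S -> Y) (g : S -> Z)
    (y : Y) (z : Z) : Prop :=
  forall V : set Z, nbhs z V ->
    exists2 U : set Y, nbhs y U & g @` (kappa @^-1` (U `\ y)) `<=` V.

End compactification.

Section differentiability.
Variables (R : realType) (n : nat).
Implicit Types (A : set 'rV[R]_n) (m : nat).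

Definition basis_vec (j : 'I_n) : 'rV[R]_n := delta_mx ord0 j.

Definition pderiv1 (j : 'I_n) (g : 'rV[R]_n -> R) : 'rV[R]_n -> R :=
  fun x => 'D_(basis_vec j) g x.

(* Multi-indices have bounded entries; this loses nothing, since the entries
   of a multi-index p with |p| <= m are at most m. *)
Definition P_ m : {set {ffun 'I_n -> 'I_m.+1}} :=
  [set p : {ffun 'I_n -> 'I_m.+1} | (\sum_j p j <= m)%N]%SET.

(* d^|p| / dx_1^p_1 ... dx_n^p_n, the derivative in x_n being taken first *)
Definition pderiv m (p : {ffun 'I_n -> 'I_m.+1}) (g : 'rV[R]_n -> R) : 'rV[R]_n -> R :=
  foldr (fun j h => iter (p j) (pderiv1 j) h) g (enum 'I_n).

(* C^m(A) for open [A]; only the values of [g] on [A] matter. *)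
Fixpoint Cm A m (g : 'rV[R]_n -> R) : Prop :=
  {in A, continuous g} /\
  match m with
  | 0%N => True
  | k.+1 => forall j : 'I_n,
      (forall x, A x -> derivable g x (basis_vec j)) /\ Cm A k (pderiv1 j g)
  end.

(* d_p f on A; the extension of [f] by 0 outside of [closure A] is irrelevant
   at the points of the open set [A]. *)
Definition ipderiv A m (p : {ffun 'I_n -> 'I_m.+1}) (f : closure A -> R) :
    'rV[R]_n -> R :=
  pderiv p ('valL_0 f).

(* d_p f on the closure of A: the continuous extension of d_p f from A,
   assumed to exist in the definition of [Cmc] below. *)
Definition cpderiv A m (p : {ffun 'I_n -> 'I_m.+1}) (f : closure A -> R) :
    closure A -> R :=
  fun x => lim (ipderiv p f y @[y --> within A (nbhs (\val x))]).

(* C^m(closure A): the continuous functions on the closure of A that are C^m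
   in A and whose partial derivatives up to order m extend continuously to the
   closure. *)
Definition Cmc A m : set (closure A -> R) :=
  [set f : closure A -> R | [/\ continuous f, Cm A m ('valL_0 f) &
    forall p, p \in P_ m -> exists g : closure A -> R,
      continuous g /\
      forall x : closure A, A (\val x) -> g x = ipderiv p f (\val x)]].

Definition sup_norm (T : Type) (f : T -> R) : \bar R :=
  ereal_sup (range (fun x => `|f x|%:E)).

Definition norm_m A m (f : closure A -> R) : \bar R :=
  \big[maxe/-oo%E]_(p in P_ m) sup_norm (cpderiv p f).

Definition BCm A m : set (closure A -> R) :=
  [set f : closure A -> R | @Cmc A m f /\ forall p, p \in P_ m ->
    [bounded cpderiv p f x | x in [set: closure A]]].

Definition fdiv A (f phi : closure A -> R) : closure A -> R :=
  fun x => f x / phi x.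

Definition Cm_kphi A m (X : topologicalType) (kappa : closure A -> X)
    (phi : closure A -> R) : set (closure A -> R) :=
  [set f : closure A -> R | @Cmc A m f /\ forall x : X, ~ range kappa x ->
    forall p, p \in P_ m ->
      exists z : R, klim kappa (cpderiv p (fdiv f phi)) x z].

Definition norm_kphi A m (phi f : closure A -> R) : \bar R :=
  norm_m m (fdiv f phi).

End differentiability.

Arguments Cmc {R n} A m _.
Arguments norm_m {R n} A m f.
Arguments BCm {R n} A m _.

(* The Banach space [E] is, via the linear map [iota], the set [S] with the
   vector space operations of [V] and the norm [N]; in particular [S] is a
   linear subspace of [V], and [N] is finite on [S]. *)
Definition is_Banach_space_on (R : realType) (V : lmodType R) (S : set V)
    (N : V -> \bar R) (E : completeNormedModType R) (iota : {linear E -> V}) :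
    Prop :=
  [/\ injective iota, range iota = S & forall e : E, `|e|%:E = N (iota e)].

(* Main.v *)
(* Multiplication by phi maps the space of all C^m functions g whose derivatives
   of order at most m have limits at the points of X outside of the range of kappa
   isometrically onto C^m_{kappa,phi}: C^m of the closure is stable under products
   and under inverses of positive functions.  By compactness of X those g lie in
   BC^m, and they form a closed subspace because a uniform limit of functions that
   have a limit along a filter has one too.
   Completeness of BC^m is the theorem on uniform convergence of derivatives,
   which follows from the mean value theorem on segments.  The norm only controls
   the derivatives taken in the order of the coordinates, while membership in C^m
   requires all iterated derivatives; these are indexed by words in the
   coordinates, and Schwarz's theorem identifies the derivatives along
   permutations of a word. *)
Require Import Defs.
From HB Require Import structures.
From mathcomp Require Import all_boot all_order all_algebra.
From mathcomp Require Import all_classical all_reals all_analysis.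
From mathcomp Require Import ring.
Set Implicit Arguments.
Unset Strict Implicit.
Unset Printing Implicit Defensive.
Import Order.TTheory GRing.Theory Num.Theory.
Import numFieldNormedType.Exports.
Local Open Scope classical_set_scope.
Local Open Scope ring_scope.

(** * Banach spaces carried by subsets of a vector space *)

Record banach_on (R : realType) (V : lmodType R) (S : set V) (N : V -> R) : Prop :=
  BanachOn {
  banach_on0 : S 0;
  banach_onP : forall (a : R) x y, S x -> S y -> S (a *: x + y);
  banach_onD : forall x y, S x -> S y -> N (x + y) <= N x + N y;
  banach_onZ : forall (a : R) x, S x -> N (a *: x) = `|a| * N x;
  banach_on_eq0 : forall x, S x -> N x = 0 -> x = 0;
  banach_on_complete : forall u : nat -> V, (forall k, S (u k)) ->
    (forall e, 0 < e -> exists K, forall k l, (K <= k)%N -> (K <= l)%N ->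
      N (u k - u l) <= e) ->
    exists2 v, S v & forall e, 0 < e -> exists K, forall k, (K <= k)%N ->
      N (v - u k) <= e }.

Section normed_subspace.
Variables (R : realType) (V : lmodType R) (S : set V) (N : V -> R).
Hypothesis SN : banach_on S N.

(** Carrying the proof of [banach_on S N] in the predicate lets the structure instances on the
    subtype below recover [N] and its axioms from the type alone. *)
Definition subspace_pred of banach_on S N : {pred V} := fun v => v \in S.
Local Notation SP := (subspace_pred SN).

Lemma subspace_submod_closed : submod_closed SP.
Proof.
split; first by apply/mem_set; exact: banach_on0 SN.
by move=> a x y /set_mem Sx /set_mem Sy; apply/mem_set; exact: (banach_onP SN).
Qed.

HB.instance Definition _ := GRing.isSubmodClosed.Build R V SP
  subspace_submod_closed.

Definition normed_subspace : Type := {v : V | v \in SP}.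
Local Notation E := normed_subspace.
HB.instance Definition _ := SubChoice.on E.
HB.instance Definition _ := [SubChoice_isSubLmodule of E by <:].

Lemma normed_subspaceP (x : E) : S (val x).
Proof. exact: (set_mem (valP x)). Qed.

Lemma normed_subspace_eq0 (x : E) : N (val x) = 0 -> x = 0.
Proof.
by move=> /(banach_on_eq0 SN (normed_subspaceP x)) x0; apply: val_inj; rewrite x0.
Qed.

HB.instance Definition _ := Lmodule_isNormed.Build R E
  (norm := fun x : E => N (val x))
  (fun x y => banach_onD SN (normed_subspaceP x) (normed_subspaceP y))
  (fun a x => banach_onZ SN a (normed_subspaceP x)) normed_subspace_eq0.

Lemma normed_subspace_normE (x : E) : `|x| = N (val x).
Proof. by []. Qed.

(** A Cauchy filter contains balls of radius [1/(k+1)]. Their centers form a Cauchy sequence, since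
    two members of a proper filter intersect, and the filter converges to the limit of that
    sequence. *)
Lemma normed_subspace_cauchy_cvg (F : set_system E) :
  ProperFilter F -> cauchy F -> cvg F.
Proof.
move=> FF /cauchyP Fc.
have /choice[u Fu] (k : nat) : exists x : E, F (ball x k.+1%:R^-1).
  by apply: Fc; rewrite invr_gt0.
have eps e : 0 < e -> exists K, forall k, (K <= k)%N -> k.+1%:R^-1 <= e :> R.
  move=> e0; exists (Num.bound e^-1) => k Kk.
  rewrite invf_ple ?posrE//; apply: le_trans (ltW (archi_boundP _)) _.
    by rewrite invr_ge0 ltW.
  by rewrite ler_nat ltnW.
have dist k l : `|u k - u l| <= k.+1%:R^-1 + l.+1%:R^-1.
  have [z [/=]] := filter_ex (filterI (Fu k) (Fu l)).
  rewrite -!ball_normE /= => zk zl; rewrite -(subrK z (u k)) -addrA.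
  by rewrite (le_trans (ler_normD _ _))// lerD// ltW// distrC.
have [] := banach_on_complete SN (fun k => normed_subspaceP (u k)).
  move=> e e0; have [K Ke] := eps _ (divr_gt0 e0 (ltr0n R 2)).
  exists K => k l Kk Kl; have := dist k l.
  rewrite normed_subspace_normE => /le_trans; apply.
  by rewrite [e]splitr lerD// Ke.
move=> v Sv uv; apply/cvg_ex; exists (Sub v (mem_set Sv)).
apply/cvgrPdist_le => e e0.
have e2 := divr_gt0 e0 (ltr0n R 2).
have [K Ke] := eps _ e2; have [L Le] := uv _ e2.
(* Half of [e] is for the radius of the ball around [u (maxn K L)], half for the distance from its
   center to the limit. *)
apply: filterS (Fu (maxn K L)) => x; rewrite -ball_normE /= => ux.
rewrite -(subrK (u (maxn K L)) (Sub _ _)) -addrA [e]splitr.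
rewrite (le_trans (ler_normD _ _))// lerD//.
  by rewrite normed_subspace_normE; apply: Le; rewrite leq_maxr.
by rewrite (le_trans (ltW ux))// Ke// leq_maxl.
Qed.

HB.instance Definition _ := Uniform_isComplete.Build E normed_subspace_cauchy_cvg.

Definition normed_subspace_val (x : E) : V := val x.

Lemma normed_subspace_val_linear : linear normed_subspace_val.
Proof. by []. Qed.

HB.instance Definition _ := GRing.isLinear.Build R E V _ normed_subspace_val
  normed_subspace_val_linear.

End normed_subspace.

Lemma is_Banach_space_on_normed_subspace (R : realType) (V : lmodType R)
    (S : set V) (N : V -> \bar R) (SN : banach_on S (fine \o N)) :
  (forall x, S x -> N x \is a fin_num) ->
  is_Banach_space_on S N (@normed_subspace_val R V S _ SN).
Proof.
move=> Nfin; split.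
- exact: val_inj.
- apply/seteqP; split => [_ [x _ <-]|x Sx]; first exact: normed_subspaceP.
  by exists (Sub x (mem_set Sx)).
- by move=> x; rewrite -[RHS]fineK// Nfin//; exact: normed_subspaceP.
Qed.

(** * Directional derivatives: mean value theorem, Schwarz's theorem, uniform limits *)

Lemma eq_dist_le (R : realFieldType) (a b : R) :
  (forall e, 0 < e -> exists2 c, `|a - c| <= e & `|b - c| <= e) -> a = b.
Proof.
move=> ab; apply/eqP; rewrite -subr_eq0 -normr_le0.
apply/ler_addgt0Pl => e e0; rewrite addr0.
have [c ac bc] := ab _ (divr_gt0 e0 (ltr0n R 2)).
by rewrite (le_trans (ler_distD c _ _))// [e]splitr lerD// distrC.
Qed.

Section directional_derivative.
Variables (R : realType) (V : normedModType R).
Implicit Types (f g : V -> R) (A : set V) (x u v : V).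

Lemma is_derive_cvgP f x v df : is_derive x v f df <->
  (fun h : R => h^-1 *: ((f \o shift x) (h *: v) - f x)) @ 0^' --> df.
Proof.
split=> [fx|H]; last by split; [apply/cvg_ex; exists df|exact: cvg_lim H].
by rewrite -(@derive_val _ _ _ _ _ _ _ fx); exact: (@ex_derive _ _ _ _ _ _ _ fx).
Qed.

Lemma is_derive_line f x v (t : R) : derivable f (x + t *: v) v ->
  is_derive t 1 (fun s => f (x + s *: v)) ('D_v f (x + t *: v)).
Proof.
move=> df; have E : (fun h : R => h^-1 *: (((fun s => f (x + s *: v)) \o shift t) (h *: 1)
      - f (x + t *: v))) =
    (fun h => h^-1 *: ((f \o shift (x + t *: v)) (h *: v) - f (x + t *: v))).
  apply/funext => h /=; congr (_ *: (f _ - _)).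
  by rewrite scaler1 scalerDl addrCA addrA.
by split; rewrite /derivable /derive E.
Qed.

(** The one-variable theorem for [s |-> f (x + s *: v)] on [[0, t]] or [[t, 0]]; bounding [c] in
    absolute value covers both signs of [t]. *)
Lemma MVT_line f x v (t : R) :
  (forall s : R, `|s| <= `|t| -> derivable f (x + s *: v) v) ->
  exists2 c, `|c| <= `|t| & f (x + t *: v) - f x = t * 'D_v f (x + c *: v).
Proof.
move=> df; pose h s := f (x + s *: v).
have dh (s : R) : `|s| <= `|t| -> is_derive s 1 h ('D_v f (x + s *: v)).
  by move=> st; apply: is_derive_line; exact: df.
have ch (a b : R) : (forall s, s \in `[a, b]%R -> `|s| <= `|t|) ->
    {within `[a, b], continuous h}.
  move=> ab; apply: continuous_in_subspaceT => s /set_mem /= /ab /dh dhs.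
  by apply: differentiable_continuous; apply/derivable1_diffP; exact: ex_derive.
have [t0|t0] := leP 0 t.
  have st s : s \in `[0, t]%R -> `|s| <= `|t|.
    by rewrite in_itv /= => /andP[s0 st]; rewrite !ger0_norm.
  have [|c ct] := @MVT_segment R h (fun s => 'D_v f (x + s *: v)) 0 t t0 _ (ch _ _ st).
    by move=> s sI; apply: dh; apply: st; exact: subset_itv_oo_cc sI.
  rewrite /h scale0r addr0 subr0 mulrC => ->; exists c => //; exact: st.
have st s : s \in `[t, 0]%R -> `|s| <= `|t|.
  by rewrite in_itv /= => /andP[s0 st]; rewrite !ler0_norm ?lerN2// ltW.
have [|c ct] := @MVT_segment R h (fun s => 'D_v f (x + s *: v)) t 0 (ltW t0) _ (ch _ _ st).
  by move=> s sI; apply: dh; apply: st; exact: subset_itv_oo_cc sI.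
rewrite /h scale0r addr0 sub0r mulrN => hE; exists c; first exact: st.
by rewrite mulrC -[RHS]opprK -hE opprB.
Qed.

Lemma open_parallelogram A x u v : open A -> A x -> exists2 d : R, 0 < d &
  forall s t : R, `|s| <= d -> `|t| <= d -> A (x + s *: u + t *: v).
Proof.
move=> oA Ax; have [e e0 eA] : exists2 e : R, 0 < e & ball x e `<=` A.
  by have /nbhs_ballP[e] := open_nbhs_nbhs (conj oA Ax); exists e.
have k0 : 0 < `|u| + `|v| + 1 by rewrite ltr_wpDl// addr_ge0.
(* The summand 1 makes the denominator positive and the final inequality strict, also when [u] and
   [v] vanish. *)
exists (e / (`|u| + `|v| + 1)) => [|s t sd td]; first exact: divr_gt0.
apply: eA; rewrite -ball_normE /= -addrA opprD addNKr normrN.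
apply: (@le_lt_trans _ _ (e / (`|u| + `|v| + 1) * (`|u| + `|v|))).
  by rewrite (le_trans (ler_normD _ _))// !normrZ mulrDr lerD// ler_wpM2r.
by rewrite mulrAC ltr_pdivrMr// ltr_pM2l// ltrDl.
Qed.

Lemma open_segment A x v : open A -> A x -> exists2 d : R, 0 < d &
  forall t : R, `|t| <= d -> A (x + t *: v).
Proof.
move=> oA Ax; have [d d0 dA] := open_parallelogram 0 v oA Ax; exists d => // t td.
by rewrite -[x]addr0 -(scaler0 _ 0); apply: dA => //; rewrite normr0 ltW.
Qed.

(** Two applications of the mean value theorem: to [F y = f (y + t *: v) - f y] along [u], then to
    ['D_u f] along [v]. The second difference is symmetric under exchange of the two directions,
    which is what Schwarz's theorem exploits. *)
Lemma second_difference f x u v (s t : R) :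
  (forall a b : R, `|a| <= `|s| -> `|b| <= `|t| ->
    derivable f (x + a *: u + b *: v) u /\
    derivable ('D_u f) (x + a *: u + b *: v) v) ->
  exists a b, [/\ `|a| <= `|s|, `|b| <= `|t| &
    f (x + s *: u + t *: v) - f (x + s *: u) - f (x + t *: v) + f x =
    s * t * 'D_v ('D_u f) (x + a *: u + b *: v)].
Proof.
move=> df; pose F y := f (y + t *: v) - f y.
have dsh y : derivable f (y + t *: v) u ->
    is_derive y u (fun z => f (z + t *: v)) ('D_u f (y + t *: v)).
  move=> dfy; have E : (fun h : R => h^-1 *: (((fun z => f (z + t *: v)) \o shift y) (h *: u)
      - f (y + t *: v))) =
    (fun h => h^-1 *: ((f \o shift (y + t *: v)) (h *: u) - f (y + t *: v))).
    by apply/funext => h /=; rewrite addrA.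
  by split; rewrite /derivable /derive E.
have t0 : `|0 : R| <= `|t| by rewrite normr0.
have dF (a : R) : `|a| <= `|s| -> is_derive (x + a *: u) u F
    ('D_u f (x + a *: u + t *: v) - 'D_u f (x + a *: u)).
  move=> as_; have [d1 _] := df a t as_ (lexx _).
  have [] := df a 0 as_ t0; rewrite scale0r addr0 => d2 _.
  exact: (@is_deriveB _ _ _ _ _ _ _ _ _ (dsh _ d1) (derivableP d2)).
have [a as_ Fa] := @MVT_line F x u s (fun a as_ => @ex_derive _ _ _ _ _ _ _ (dF a as_)).
have [b bt gb] := @MVT_line ('D_u f) (x + a *: u) v t
  (fun b bt => proj2 (df a b as_ bt)).
exists a, b; split => //.
rewrite -mulrA -gb -(@derive_val _ _ _ _ _ _ _ (dF a as_)) -Fa /F; ring.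
Qed.

Lemma continuous_near_dist f x (e : R) : {for x, continuous f} -> 0 < e ->
  \forall y \near x, `|f x - f y| <= e.
Proof. by move=> /cvgrPdist_le; exact. Qed.

(** The values may agree at different points [y] and [z], because the two mean value arguments in
    Schwarz's theorem yield different intermediate points. *)
Lemma eq_of_nearby_values f g x :
  {for x, continuous f} -> {for x, continuous g} ->
  (forall A, open A -> A x -> exists y z, [/\ A y, A z & f y = g z]) ->
  f x = g x.
Proof.
move=> cf cg fg; apply: eq_dist_le => e e0.
have Ax : [set y | `|f x - f y| <= e /\ `|g x - g y| <= e]^° x.
  exact: filterI (continuous_near_dist cf e0) (continuous_near_dist cg e0).
have [y [z [/interior_subset[fy _] /interior_subset[_ gz] yz]]] :=
  fg _ (open_interior _) Ax.
by exists (f y); rewrite ?yz// -yz.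
Qed.

(** Schwarz's theorem. In any neighborhood of [x] a small parallelogram with equal steps [d] has a
    second difference equal to [d * d] times either mixed derivative, each at a point of that
    neighborhood; continuity brings both points to [x]. *)
Lemma derive_sym A f x u v : open A -> A x ->
  (forall y, A y -> derivable f y u) -> (forall y, A y -> derivable f y v) ->
  (forall y, A y -> derivable ('D_u f) y v) ->
  (forall y, A y -> derivable ('D_v f) y u) ->
  {for x, continuous ('D_v ('D_u f))} -> {for x, continuous ('D_u ('D_v f))} ->
  'D_v ('D_u f) x = 'D_u ('D_v f) x.
Proof.
move=> oA Ax fu fv fuv fvu cuv cvu.
apply: eq_of_nearby_values cuv cvu _ => B oB Bx.
have [d d0 dAB] := open_parallelogram u v (openI oA oB) (conj Ax Bx).
have dnorm : `|d| = d by rewrite gtr0_norm.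
have [|a [b [ad bd fE]]] := @second_difference f x u v d d.
  move=> a b; rewrite dnorm => ad bd.
  by have [Ay _] := dAB _ _ ad bd; split; [exact: fu|exact: fuv].
have [|b' [a' [bd' ad' fE']]] := @second_difference f x v u d d.
  move=> b' a'; rewrite dnorm => bd' ad'.
  have [] := dAB _ _ ad' bd'; rewrite addrAC => Ay _.
  by split; [exact: fv|exact: fvu].
rewrite dnorm in ad bd ad' bd'; rewrite (addrAC x (d *: v)) in fE'.
exists (x + a *: u + b *: v), (x + b' *: v + a' *: u); split.
- by have [_] := dAB _ _ ad bd.
- by rewrite addrAC; have [_] := dAB _ _ ad' bd'.
apply: (@mulfI _ (d * d)); first by rewrite mulf_neq0// gt_eqF.
by apply: etrans (esym fE) _; apply: etrans fE'; ring.
Qed.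

(* The mean value theorem applied to the difference of two approximants bounds
   the difference quotients of [g] by those of a single approximant. *)
Lemma is_derive_uniform_limit A g dg x v : open A -> A x ->
  (forall e : R, 0 < e -> exists2 f, (forall y, A y -> derivable f y v) &
    forall y, A y -> `|f y - g y| <= e /\ `|'D_v f y - dg y| <= e) ->
  is_derive x v g (dg x).
Proof.
move=> oA Ax fg.
apply/is_derive_cvgP/cvgrPdist_le => e e0.
have e3 : 0 < e / 3 by rewrite divr_gt0.
have [f df fge] := fg _ e3.
have [d d0 dA] := open_segment v oA Ax.
have fx : (fun h : R => h^-1 *: ((f \o shift x) (h *: v) - f x)) @ 0^' --> 'D_v f x.
  exact: df.
near=> h.
have h0 : h != 0 by near: h; exact: nbhs_dnbhs_neq.
have hd : `|h| <= d by near: h; exact: dnbhs0_le.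
have fxh : `|'D_v f x - h^-1 *: (f (h *: v + x) - f x)| <= e / 3.
  by near: h; exact: cvgr_dist_le fx _ e3.
have quot : `|(f (h *: v + x) - f x) - (g (h *: v + x) - g x)| <= `|h| * (e / 3).
  apply/ler_addgt0Pl => r r0.
  (* A second approximant [f2] stands in for [g]. With [r' = r / (|h| + 2)] its errors, [r' + r']
     from the values and [|h| * r'] from the derivative, add up to the arbitrary [r]. *)
  have [f2 df2 f2g] := fg (r / (`|h| + 2)) (divr_gt0 r0 (ltr_wpDl (normr_ge0 h) (ltr0n _ 2))).
  set r' := r / _ in df2 f2g.
  have dff2 (t : R) : `|t| <= `|h| -> is_derive (x + t *: v) v (f2 - f)
      ('D_v f2 (x + t *: v) - 'D_v f (x + t *: v)).
    move=> th; have At := dA t (le_trans th hd).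
    by apply: is_deriveB; apply: derivableP; [exact: df2|exact: df].
  have [t th ff2] := MVT_line (fun t th => @ex_derive _ _ _ _ _ _ _ (dff2 t th)).
  have At := dA t (le_trans th hd); have Ah := dA h hd.
  rewrite (@derive_val _ _ _ _ _ _ _ (dff2 t th)) in ff2.
  have {}ff2 : f2 (x + h *: v) - f (x + h *: v) - (f2 x - f x) =
    h * ('D_v f2 (x + t *: v) - 'D_v f (x + t *: v)) := ff2.
  have [f2x _] := f2g x Ax; have [f2h _] := f2g _ Ah.
  have [_ f2t] := f2g _ At; have [_ ft] := fge _ At.
  have D : `|'D_v f2 (x + t *: v) - 'D_v f (x + t *: v)| <= r' + e / 3.
    rewrite -(subrK (dg (x + t *: v)) ('D_v f2 _)) -addrA.
    by rewrite (le_trans (ler_normD _ _))// lerD// distrC.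
  have -> : f (h *: v + x) - f x - (g (h *: v + x) - g x) =
      (f2 (x + h *: v) - g (x + h *: v)) - (f2 x - g x) -
      (f2 (x + h *: v) - f (x + h *: v) - (f2 x - f x)).
    by rewrite [h *: v + x]addrC; ring.
  have -> : r + `|h| * (e / 3) = r' + r' + `|h| * (r' + e / 3).
    by rewrite /r'; field; rewrite gt_eqF// ltr_wpDl.
  rewrite (le_trans (ler_normB _ _))// lerD//.
    by rewrite (le_trans (ler_normB _ _))// lerD.
  by rewrite ff2 normrM ler_wpM2l.
(* Three thirds of [e]: from [dg x] to ['D_v f x], on to the quotient of [f], and on to the quotient
   of [g]. *)
rewrite -(subrK (h^-1 *: (f (h *: v + x) - f x)) (dg x)) -addrA.
rewrite -(subrK ('D_v f x) (dg x)) -(addrA (_ - _)).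
have -> : e = e / 3 + e / 3 + e / 3 by field.
rewrite (le_trans (ler_normD _ _))// lerD//.
  rewrite (le_trans (ler_normD _ _))// lerD//.
  by have [_] := fge _ Ax; rewrite distrC.
rewrite -scalerBr normrZ normfV ler_pdivrMl ?normr_gt0//.
Unshelve. all: by end_near.
Qed.
(** Short segments through [x] stay in the open set [A], so the quotients agree near 0. Equality of
    the image filters transfers both the existence and the value of the derivative. *)
Lemma eq_on_difference_quotient A f g x v : open A -> A x -> {in A, f =1 g} ->
  (fun h : R => h^-1 *: ((f \o shift x) (h *: v) - f x)) @ 0^' =
  (fun h : R => h^-1 *: ((g \o shift x) (h *: v) - g x)) @ 0^'.
Proof.
move=> oA Ax fg; have [d d0 dA] := open_segment v oA Ax.
have E : {near 0^', (fun h : R => h^-1 *: ((f \o shift x) (h *: v) - f x)) =1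
    (fun h : R => h^-1 *: ((g \o shift x) (h *: v) - g x))}.
  apply: filterS (dnbhs0_le d0) => h hd; rewrite /= !fg ?inE//.
  by rewrite addrC; exact: dA.
apply/seteqP; split; first exact: near_eq_cvg E.
by apply: (@near_eq_cvg _ _ _ _ (fun h => h^-1 *: _)); apply: filterS E => h ->.
Qed.

Lemma eq_on_derive A f g x v : open A -> A x -> {in A, f =1 g} ->
  'D_v f x = 'D_v g x.
Proof.
by move=> oA Ax fg; rewrite /derive (eq_on_difference_quotient v oA Ax fg).
Qed.

Lemma eq_on_derivable A f g x v : open A -> A x -> {in A, f =1 g} ->
  derivable f x v -> derivable g x v.
Proof.
by move=> oA Ax fg; rewrite /derivable (eq_on_difference_quotient v oA Ax fg).
Qed.

End directional_derivative.

(** * Iterated partial derivatives along words, and regularity classes *)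

Section partial_derivatives.
Variables (R : realType) (n : nat).
Implicit Types (A : set 'rV[R]_n) (m : nat) (f g h : 'rV[R]_n -> R)
  (w : seq 'I_n) (j : 'I_n) (P : ('rV[R]_n -> R) -> Prop).

Definition pderivw w g := foldr (@pderiv1 R n) g w.

Lemma pderivw_rcons w j g : pderivw (rcons w j) g = pderivw w (pderiv1 j g).
Proof. exact: foldr_rcons. Qed.

Lemma pderivw_cat w1 w2 g : pderivw (w1 ++ w2) g = pderivw w1 (pderivw w2 g).
Proof. exact: foldr_cat. Qed.

Lemma eq_on_pderiv1 A f g j : open A -> {in A, f =1 g} ->
  {in A, pderiv1 j f =1 pderiv1 j g}.
Proof. by move=> oA fg x /set_mem Ax; exact: eq_on_derive fg. Qed.

Lemma eq_on_pderivw A f g w : open A -> {in A, f =1 g} ->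
  {in A, pderivw w f =1 pderivw w g}.
Proof. by move=> oA; elim: w => //= j w IHw /IHw; exact: eq_on_pderiv1. Qed.

Definition all_derivable A g :=
  forall j x, A x -> derivable g x (basis_vec R j).

Lemma eq_on_all_derivable A f g : open A -> {in A, f =1 g} ->
  all_derivable A f -> all_derivable A g.
Proof. by move=> oA fg df j x Ax; apply: eq_on_derivable fg (df j x Ax). Qed.

(* With [P] continuity on [A] this is [Cm]; with [P] the existence of a
   continuous extension to the closure it is the interior part of [Cmc], except
   that here the derivatives are taken in any order. *)
Fixpoint Creg P A m g : Prop :=
  P g /\ match m with
  | 0%N => True
  | k.+1 => all_derivable A g /\ forall j, Creg P A k (pderiv1 j g)
  end.

Lemma Creg_prop P A m g : Creg P A m g -> P g.
Proof. by case: m => [|m] []. Qed.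

Lemma Creg_sub P P' A m g : (forall f, P f -> P' f) -> Creg P A m g -> Creg P' A m g.
Proof.
move=> PP'; elim: m g => [|m IHm] g /= [/PP' Pg]; first by [].
by move=> [dg Dg]; do 2 split => //; move=> j; exact: IHm.
Qed.

Lemma CregS P A m g : Creg P A m.+1 g -> Creg P A m g.
Proof.
elim: m g => [|m IHm] g [Pg [dg Dg]] //; do 2 split => //.
by move=> j; apply: IHm; exact: Dg.
Qed.

(** Words are split at their last letter, since it is the derivative taken first and the one that
    [Creg] peels off. *)
Lemma Creg_wordP P A m g : Creg P A m g <->
  forall w, (size w <= m)%N -> P (pderivw w g) /\
    ((size w < m)%N -> all_derivable A (pderivw w g)).
Proof.
split.
  elim: m g => [|m IHm] g; first by move=> [Pg _] [].
  move=> [Pg [dg Dg]]; elim/last_ind => [//|w j _].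
  by rewrite size_rcons pderivw_rcons !ltnS; exact: IHm (Dg j) w.
elim: m g => [|m IHm] g H; first by have [] := H [::] isT.
have [Pg dg] := H [::] isT; do 2 split => //; first exact: dg.
by move=> j; apply: IHm => w; have := H (rcons w j); rewrite size_rcons pderivw_rcons !ltnS.
Qed.

Lemma Cm_Creg A m g : Cm A m g <-> Creg (fun f => {in A, continuous f}) A m g.
Proof.
elim: m g => [//|m IHm] g /=; split.
  move=> [cg Dg]; split=> //; split; first by move=> j x; have [dg _] := Dg j; exact: dg.
  by move=> j; apply/IHm; have [] := Dg j.
by move=> [cg [dg Dg]]; split=> // j; split; [exact: dg|exact/IHm].
Qed.

(** What [P] must satisfy for [Creg P] to be stable under sums, products and inverses. Invariance
    under changes off [A] enters because the differentiation rules hold on [A] only. *)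
Record local_algebra A P : Prop := LocalAlgebra {
  local_algebra_eq : forall f g, {in A, f =1 g} -> P f -> P g;
  local_algebra_lin : forall (a : R) f g, P f -> P g -> P (a *: f + g);
  local_algebraM : forall f g, P f -> P g -> P (f * g) }.

Lemma Creg_eq_on P A m f g : open A -> local_algebra A P ->
  {in A, f =1 g} -> Creg P A m f -> Creg P A m g.
Proof.
move=> oA PA; have Peq := local_algebra_eq PA.
elim: m f g => [|m IHm] f g fg [Pf].
  by move=> _; split=> //; exact: Peq Pf.
move=> [df Df]; split; first exact: Peq Pf.
split; first exact: eq_on_all_derivable df.
by move=> j; apply: IHm (Df j); exact: eq_on_pderiv1.
Qed.

Lemma Creg0 P A m : P 0 -> Creg P A m 0.
Proof.
move=> P0; elim: m => [//|m IHm]; split=> //; split.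
  by move=> j x _; exact: derivable_cst.
move=> j; suff -> : pderiv1 j (0 : 'rV[R]_n -> R) = 0 by [].
by apply/funext => x; exact: derive_cst.
Qed.

Section linear_combination.
Variables (A : set 'rV[R]_n) (a : R).

Lemma all_derivable_lin f g : all_derivable A f -> all_derivable A g ->
  all_derivable A (a *: f + g).
Proof.
by move=> df dg j x Ax; apply: derivableD; [apply: derivableZ; exact: df|exact: dg].
Qed.

Lemma pderiv1_lin f g j x : A x -> all_derivable A f -> all_derivable A g ->
  pderiv1 j (a *: f + g) x = (a *: pderiv1 j f + pderiv1 j g) x.
Proof.
move=> Ax df dg; rewrite /pderiv1 deriveD; last 2 first.
- by apply: derivableZ; exact: df.
- exact: dg.
by rewrite deriveZ//; exact: df.
Qed.

Lemma pderivw_lin P m f g w : open A -> Creg P A m f -> Creg P A m g ->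
  (size w <= m)%N ->
  {in A, pderivw w (a *: f + g) =1 a *: pderivw w f + pderivw w g}.
Proof.
move=> oA; elim/last_ind: w m f g => [//|w j IHw] [//|m] f g.
  by rewrite size_rcons.
move=> [_ [df Df]] [_ [dg Dg]]; rewrite size_rcons ltnS !pderivw_rcons => wm x xA.
rewrite -(IHw m _ _ (Df j) (Dg j))//.
apply: (@eq_on_pderivw A _ _ w oA _ x xA) => y /set_mem Ay.
exact: pderiv1_lin.
Qed.

Lemma Creg_lin P m f g : open A -> local_algebra A P ->
  Creg P A m f -> Creg P A m g -> Creg P A m (a *: f + g).
Proof.
move=> oA PA; have Plin := local_algebra_lin PA.
elim: m f g => [|m IHm] f g [Pf Df] [Pg Dg].
  by split=> //; exact: Plin.
case: Df Dg => [df Df] [dg Dg]; split; first exact: Plin.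
split; first exact: all_derivable_lin.
move=> j; apply: Creg_eq_on (IHm _ _ (Df j) (Dg j)) => // x /set_mem Ax.
by rewrite -pderiv1_lin.
Qed.

End linear_combination.

Lemma all_derivableM A f g : all_derivable A f -> all_derivable A g ->
  all_derivable A (f * g).
Proof. by move=> df dg j x Ax; apply: derivableM; [exact: df|exact: dg]. Qed.

(** By the product rule a first derivative is [f * Dg + g * Df]; [CregS] lowers the undifferentiated
    factors to order [m], so the induction hypothesis covers both products. *)
Lemma CregM P A m f g : open A -> local_algebra A P ->
  Creg P A m f -> Creg P A m g -> Creg P A m (f * g).
Proof.
move=> oA PA; have PM := local_algebraM PA.
elim: m f g => [|m IHm] f g Rf Rg.
  by split=> //; apply: PM; [exact: Creg_prop Rf|exact: Creg_prop Rg].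
have [[Pf [df Df]] [Pg [dg Dg]]] := (Rf, Rg); split; first exact: PM.
split; first exact: all_derivableM.
move=> j; have := Creg_lin 1 oA PA (IHm _ _ (CregS Rf) (Dg j))
  (IHm _ _ (CregS Rg) (Df j)).
apply: Creg_eq_on => // x /set_mem Ax.
by rewrite scale1r /pderiv1 deriveM//; [exact: df|exact: dg].
Qed.

(** The derivative of [1/f] is minus the product of [1/f], [1/f] and [Df], all of class [m] by
    induction; so [P] is assumed of [1/f] itself but not of its derivatives. *)
Lemma CregV P A m f : open A -> local_algebra A P ->
  (forall x, A x -> f x != 0) -> P (fun x => (f x)^-1) ->
  Creg P A m f -> Creg P A m (fun x => (f x)^-1).
Proof.
move=> oA PA f0 PV; elim: m => [//|m IHm] Rf.
have [Pf [df Df]] := Rf; have RV := IHm (CregS Rf).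
split=> //; split.
  by move=> j x Ax; apply: derivableV; [exact: f0|exact: df].
move=> j; have RVD := CregM oA PA (CregM oA PA RV RV) (Df j).
(* -2 p + p = - p *)
apply: Creg_eq_on (Creg_lin (- 2) oA PA RVD RVD) => // x /set_mem Ax.
rewrite /pderiv1 deriveV; [|exact: f0|exact: df].
by rewrite !fctE /GRing.scale /= expr2 invfM; ring.
Qed.

End partial_derivatives.

(** * Symmetry of iterated derivatives; words and multi-indices *)

Section derivatives_of_Cm_functions.
Variables (R : realType) (n : nat).
Implicit Types (A : set 'rV[R]_n) (m : nat) (g : 'rV[R]_n -> R)
  (w : seq 'I_n) (j : 'I_n).

(** Induction on [w1]: below the outermost derivative the letter [j] already moves to the front, and
    Schwarz's theorem then exchanges these two. *)
Lemma pderivw_move A m g w1 j w2 : open A -> Cm A m g ->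
  (size (w1 ++ j :: w2) <= m)%N ->
  {in A, pderivw (w1 ++ j :: w2) g =1 pderivw (j :: w1 ++ w2) g}.
Proof.
move=> oA /Cm_Creg/Creg_wordP gW.
elim: w1 => [//|k w1 IHw1] /=; rewrite size_cat /= addnS => wm x xA.
set h := pderivw (w1 ++ w2) g.
have wm1 : (size (w1 ++ j :: w2) <= m)%N by rewrite size_cat /= addnS ltnW.
transitivity (pderiv1 k (pderiv1 j h) x).
  exact: eq_on_pderiv1 oA (IHw1 wm1) x xA.
rewrite -size_cat in wm.
have [_ /(_ (ltnW wm)) dh] := gW (w1 ++ w2) (ltnW (ltnW wm)).
have [_ /(_ wm) djh] := gW (j :: w1 ++ w2) (ltnW wm).
have [_ /(_ wm) dkh] := gW (k :: w1 ++ w2) (ltnW wm).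
have [cjk _] := gW (k :: j :: w1 ++ w2) wm.
have [ckj _] := gW (j :: k :: w1 ++ w2) wm.
exact: (@derive_sym R _ A h x _ _ oA (set_mem xA) (dh j) (dh k) (djh k) (dkh j)
  (cjk x xA) (ckj x xA)).
Qed.

(** The first letter of [w] is found in [w'] and moved to the front there; the remaining words are
    again permutations of each other. *)
Lemma pderivw_perm A m g w w' : open A -> Cm A m g -> (size w <= m)%N ->
  perm_eq w w' -> {in A, pderivw w g =1 pderivw w' g}.
Proof.
move=> oA gC; elim: w w' => [|j w IHw] w' wm ww'.
  by move: ww'; rewrite perm_sym => /perm_nilP ->.
have jw' : j \in w' by rewrite -(perm_mem ww') mem_head.
case/splitPr: jw' ww' => w1 w2 ww'; have sz := perm_size ww'.
move: ww'; rewrite perm_sym -[j :: w2]cat1s perm_catCA perm_cons perm_sym => ww.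
move=> x xA; rewrite (pderivw_move oA gC) -?sz//.
exact: eq_on_pderiv1 oA (IHw _ (ltnW wm) ww) x xA.
Qed.

Definition index_word m (p : {ffun 'I_n -> 'I_m.+1}) : seq 'I_n :=
  flatten [seq nseq (p j) j | j <- enum 'I_n].

Lemma pderiv_word m (p : {ffun 'I_n -> 'I_m.+1}) g :
  pderiv p g = pderivw (index_word p) g.
Proof.
rewrite /pderiv /index_word; elim: (enum 'I_n) => //= j s ->.
rewrite pderivw_cat; move: (pderivw _ g) => h.
by elim: (nat_of_ord (p j)) => //= k ->.
Qed.

Lemma count_index_word m (p : {ffun 'I_n -> 'I_m.+1}) j :
  count_mem j (index_word p) = p j.
Proof.
rewrite /index_word count_flatten -map_comp sumnE big_map big_enum /=.
rewrite (bigD1 j)//= big1 ?addn0 => [|k kj]; rewrite count_nseq /= ?eqxx ?mul1n//.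
by rewrite (negbTE kj) mul0n.
Qed.

Lemma size_index_word m (p : {ffun 'I_n -> 'I_m.+1}) :
  size (index_word p) = (\sum_j p j)%N.
Proof.
rewrite /index_word size_flatten /shape -map_comp sumnE big_map big_enum /=.
by apply: eq_bigr => j _; rewrite size_nseq.
Qed.

(** [inord] falls back to 0 on counts above [m]; a word of length at most [m] has no such count. *)
Definition word_index m w : {ffun 'I_n -> 'I_m.+1} :=
  [ffun j => inord (count_mem j w)].

Lemma word_indexK m (p : {ffun 'I_n -> 'I_m.+1}) :
  word_index m (index_word p) = p.
Proof. by apply/ffunP => j; rewrite ffunE count_index_word inord_val. Qed.

Lemma perm_index_word m w : (size w <= m)%N ->
  perm_eq w (index_word (word_index m w)).
Proof.
move=> wm; apply/allP => j _ /=; rewrite count_index_word ffunE inordK//.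
by rewrite ltnS (leq_trans (count_size _ _)).
Qed.

Lemma word_index_P_ m w : (size w <= m)%N -> word_index m w \in P_ n m.
Proof.
by move=> wm; rewrite inE -size_index_word -(perm_size (perm_index_word wm)).
Qed.

End derivatives_of_Cm_functions.

(** * Continuous extension from [A] to its closure *)

Lemma continuous_lin (R : realType) (T : topologicalType) (a : R) (f g : T -> R) :
  continuous f -> continuous g -> continuous (a *: f + g).
Proof. by move=> cf cg x; apply: cvgD; [apply: cvgZ (cf x); exact: cvg_cst|exact: cg]. Qed.

Section continuous_extension.
Variables (R : realType) (T : topologicalType) (A : set T).
Implicit Types (g : T -> R) (f : closure A -> R) (x : closure A).

Definition extends_to_closure g := exists f : closure A -> R,
  continuous f /\ forall x : closure A, A (\val x) -> f x = g (\val x).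

Lemma valL0E f x : 'valL_0 f (\val x) = f x.
Proof. by have := congr1 (@^~ x) (valLK 0 f). Qed.

(** Continuity on the subtype becomes a limit in the ambient space along points of the closure only,
    as the zero extension may jump at the boundary. *)
Lemma cvg_within_closure f x : continuous f ->
  'valL_0 f @ within (closure A) (nbhs (\val x)) --> f x.
Proof.
move=> cf; rewrite -[f x]valL0E.
suff /subspace_continuousP : {within closure A, continuous ('valL_0 f)}.
  by apply; exact: set_mem (valP x).
by apply/subspace_sigL_continuousP; rewrite valLK.
Qed.

Lemma closure_sub (y : T) : A y -> exists x : closure A, \val x = y.
Proof. by move=> /subset_closure/mem_set Ay; exists (Sub y Ay). Qed.

Lemma valL0_eq_on f g : (forall x : closure A, A (\val x) -> f x = g (\val x)) ->
  {in A, 'valL_0 f =1 g}.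
Proof.
by move=> fg y /set_mem Ay; have [x xy] := closure_sub Ay; rewrite -xy valL0E fg// xy.
Qed.

(** [A] is dense in its closure, so the limit along [A] is unique and every continuous extension
    takes it as value. This is how [cpderiv] is evaluated. *)
Lemma lim_within_closure f g x : continuous f ->
  (forall x : closure A, A (\val x) -> f x = g (\val x)) ->
  lim (g y @[y --> within A (nbhs (\val x))]) = f x.
Proof.
move=> cf fg; have Px : ProperFilter (within A (nbhs (\val x))).
  by apply: within_nbhs_proper; exact: set_mem (valP x).
apply: cvg_lim => //; apply: cvg_trans (_ : 'valL_0 f @ within A (nbhs (\val x)) --> f x).
  apply: near_eq_cvg; have : within A (nbhs (\val x)) A by exact: withinT.
  by apply: filterS => y /mem_set/(valL0_eq_on fg).
apply: cvg_trans; last exact: (@cvg_within_closure f x cf). apply: cvg_app.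
by apply: within_subset => y; exact: subset_closure.
Qed.

(** At a point of the open set [A], neighborhoods within the closure are ordinary neighborhoods. *)
Lemma extends_continuous g : open A -> extends_to_closure g -> {in A, continuous g}.
Proof.
move=> oA [f [cf fg]] y /set_mem Ay; have [x xy] := closure_sub Ay.
rewrite -xy in Ay *; rename Ay into Ax.
have nA : nbhs (\val x) A by exact: open_nbhs_nbhs (conj oA Ax).
rewrite /continuous_at -fg//.
apply: cvg_trans (_ : 'valL_0 f @ nbhs (\val x) --> f x).
  by apply: near_eq_cvg; apply: (filterS _ nA) => z /mem_set/(valL0_eq_on fg).
have := @cvg_within_closure f x cf; rewrite within_interior//.
exact: filterS (@subset_closure _ A) nA.
Qed.

End continuous_extension.

Lemma extends_local_algebra (R : realType) (n : nat) (A : set 'rV[R]_n) :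
  local_algebra A (@extends_to_closure R _ A).
Proof.
split=> [g h gh [f [cf fg]]|a g h [f [cf fg]] [f' [cf' fh]]|
  g h [f [cf fg]] [f' [cf' fh]]].
- by exists f; split=> // x Ax; rewrite fg// gh ?inE.
- exists (a *: f + f'); split=> [x|x Ax]; last by rewrite !fctE fg// fh.
  exact: continuous_lin cf cf' x.
- exists (f * f'); split=> [x|x Ax]; last by rewrite !fctE fg// fh.
  by apply: continuousM; [exact: cf|exact: cf'].
Qed.

(** * The algebra of [C^m] functions on the closure *)

Section Cmc.
Variables (R : realType) (n m : nat) (A : set 'rV[R]_n).
Hypothesis oA : open A.
Implicit Types (f g : closure A -> R) (x : closure A).

(** [Cmc] asks for extensions of the derivatives in coordinate order only; by symmetry they serve
    for all words. Conversely, a derivative that extends continuously is continuous in [A]. *)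
Lemma CmcP f : Cmc A m f <-> continuous f /\
  Creg (@extends_to_closure R _ A) A m ('valL_0 f).
Proof.
split=> [[cf fC fext]|[cf /[dup] fE /Creg_wordP fW]]; split=> //.
- apply/Creg_wordP => w wm; split; last first.
    by have /Cm_Creg/Creg_wordP/(_ w wm)[] := fC.
  have [g [cg gf]] := fext _ (word_index_P_ wm).
  exists g; split=> // x Ax; rewrite gf// /ipderiv pderiv_word.
  by rewrite (pderivw_perm oA fC wm (perm_index_word wm)) ?inE.
- by apply/Cm_Creg; apply: Creg_sub fE => g; exact: extends_continuous.
- move=> p; rewrite inE -size_index_word => pm; have [[g [cg gf]] _] := fW _ pm.
  by exists g; split=> // x Ax; rewrite gf// /ipderiv pderiv_word.
Qed.

Lemma cpderiv_unique p f g : continuous g ->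
  (forall x, A (\val x) -> g x = ipderiv p f (\val x)) -> @cpderiv R n A m p f = g.
Proof. by move=> cg gf; apply/funext => x; exact: lim_within_closure. Qed.

Lemma cpderivP p f : Cmc A m f -> p \in P_ n m ->
  continuous (cpderiv p f) /\
  forall x, A (\val x) -> cpderiv p f x = ipderiv p f (\val x).
Proof.
by move=> [_ _ fC] /fC[g [cg gf]]; rewrite (cpderiv_unique cg gf).
Qed.

Definition index0 : {ffun 'I_n -> 'I_m.+1} := [ffun=> ord0].

Lemma index0_P_ : index0 \in P_ n m.
Proof. by rewrite inE big1// => j _; rewrite ffunE. Qed.

Lemma cpderiv0 f : continuous f -> cpderiv index0 f = f.
Proof.
move=> cf; apply: cpderiv_unique => // x _; rewrite /ipderiv pderiv_word.
have /size0nil -> : size (index_word index0) = 0%N.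
  by rewrite size_index_word big1// => j _; rewrite ffunE.
by rewrite [RHS]valL0E.
Qed.

Lemma valL0_lin (a : R) f g : 'valL_0 (a *: f + g) = a *: 'valL_0 f + 'valL_0 g.
Proof.
apply/funext => y; rewrite !fctE /= oinv_set_val; case: insubP => //= _.
by rewrite scaler0 addr0.
Qed.

Lemma valL0M f g : 'valL_0 (f * g) = 'valL_0 f * 'valL_0 g.
Proof.
by apply/funext => y; rewrite !fctE /= oinv_set_val; case: insubP => //= _; rewrite mulr0.
Qed.

Lemma valL0V f : 'valL_0 (fun x => (f x)^-1) = (fun y => ('valL_0 f y)^-1).
Proof.
(* Off the closure both sides are 0, by the convention that the inverse of 0 is 0. *)
by apply/funext => y; rewrite /= oinv_set_val; case: insubP => //= _; rewrite invr0.
Qed.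

Lemma Cmc0 : Cmc A m 0.
Proof.
have c0 : continuous (fun _ : closure A => 0 : R) by exact: cst_continuous.
apply/CmcP; split; first exact: c0.
have -> : 'valL_0 (0 : closure A -> R) = 0.
  by apply/funext => y; rewrite /= oinv_set_val; case: insubP.
by apply: Creg0; exists (fun=> 0).
Qed.

Lemma Cmc_lin (a : R) f g : Cmc A m f -> Cmc A m g -> Cmc A m (a *: f + g).
Proof.
move=> /CmcP[cf fE] /CmcP[cg gE]; apply/CmcP; split.
  exact: continuous_lin.
by rewrite valL0_lin; apply: Creg_lin fE gE => //; exact: extends_local_algebra.
Qed.

Lemma CmcM f g : Cmc A m f -> Cmc A m g -> Cmc A m (f * g).
Proof.
move=> /CmcP[cf fE] /CmcP[cg gE]; apply/CmcP; split.
  by move=> x; apply: continuousM; [exact: cf|exact: cg].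
by rewrite valL0M; apply: CregM fE gE => //; exact: extends_local_algebra.
Qed.

Lemma CmcV f : Cmc A m f -> (forall x, f x != 0) -> Cmc A m (fun x => (f x)^-1).
Proof.
move=> /CmcP[cf fE] f0; have cV : continuous (fun x => (f x)^-1).
  by move=> x; apply: continuousV; [exact: f0|exact: cf].
apply/CmcP; split=> //; rewrite valL0V; apply: CregV fE => //.
- exact: extends_local_algebra.
- by move=> _ /closure_sub[x <-]; rewrite valL0E.
- by exists (fun x => (f x)^-1); split=> // x _; rewrite valL0E.
Qed.

Lemma cpderiv_lin p (a : R) f g : Cmc A m f -> Cmc A m g -> p \in P_ n m ->
  cpderiv p (a *: f + g) = a *: cpderiv p f + cpderiv p g.
Proof.
move=> fC gC pm; have [cf fE] := cpderivP fC pm; have [cg gE] := cpderivP gC pm.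
apply: cpderiv_unique => [x|x Ax].
  exact: continuous_lin cf cg x.
rewrite !fctE fE// gE// /ipderiv !pderiv_word valL0_lin.
rewrite inE -size_index_word in pm.
have [_ fR] := iffLR (CmcP f) fC; have [_ gR] := iffLR (CmcP g) gC.
by rewrite (pderivw_lin a oA fR gR pm) ?inE.
Qed.

End Cmc.

(** * Uniform limits of functions *)

Lemma continuous_uniform_limit (R : realType) (T : topologicalType) (g : T -> R) :
  (forall e : R, 0 < e -> exists2 f, continuous f & forall x, `|f x - g x| <= e) ->
  continuous g.
Proof.
move=> fg x; apply/cvgrPdist_le => e e0; have e3 : 0 < e / 3 by rewrite divr_gt0.
have [f cf fge] := fg _ e3; have /cvgrPdist_le/(_ _ e3) := cf x.
apply: filterS => y fxy; have -> : e = e / 3 + e / 3 + e / 3 by field.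
rewrite (le_trans (ler_distD (f y) _ _))// lerD//.
by rewrite (le_trans (ler_distD (f x) _ _))// lerD// distrC.
Qed.

(** The limit is taken pointwise; letting [l] tend to infinity in the Cauchy estimate with [k] fixed
    makes the convergence uniform. *)
Lemma uniformly_cauchy_limit (R : realType) (T : Type) (v : nat -> T -> R) :
  (forall e : R, 0 < e -> exists K, forall k l, (K <= k)%N -> (K <= l)%N ->
    forall x, `|v k x - v l x| <= e) ->
  exists g : T -> R, forall e : R, 0 < e -> exists K, forall k, (K <= k)%N ->
    forall x, `|v k x - g x| <= e.
Proof.
move=> vC; have cv x : cvg (v k x @[k --> \oo]).
  apply/cauchy_cvgP/cauchy_exP => e e0; have [K Ke] := vC _ (divr_gt0 e0 (ltr0n R 2)).
  exists (v K x); exists K => // k Kk; rewrite -ball_normE /=.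
  by rewrite (le_lt_trans (Ke _ _ _ _ _))// ltr_pdivrMr// ltr_pMr// ltr1n.
exists (fun x => lim (v k x @[k --> \oo])) => e e0; have [K Ke] := vC _ e0.
exists K => k Kk x.
have vl : `|v k x - v l x| @[l --> \oo] --> `|v k x - lim (v l x @[l --> \oo])|.
  by apply: cvg_norm; apply: cvgB; [exact: cvg_cst|exact: cv].
by apply: cvgr_to_le vl _; exists K => // l Kl; exact: Ke.
Qed.

(** * Uniform limits of jets, a jet being the family of derivatives of one function up to order
    [m] *)

Section jets.
Variables (R : realType) (n m : nat) (A : set 'rV[R]_n).
Hypothesis oA : open A.
Variable G : {ffun 'I_n -> 'I_m.+1} -> closure A -> R.
Hypothesis GP : forall e : R, 0 < e -> exists2 f, Cmc A m f &
  forall p, p \in P_ n m -> forall x, `|cpderiv p f x - G p x| <= e.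

Lemma jet_limit_continuous p : p \in P_ n m -> continuous (G p).
Proof.
move=> pm; apply: continuous_uniform_limit => e /GP[f fC fG].
exists (cpderiv p f); last exact: fG.
by have [] := cpderivP fC pm.
Qed.

(** The limit jet indexed by words, so that adding a letter can be compared with one more
    differentiation. *)
Let H (w : seq 'I_n) : 'rV[R]_n -> R := 'valL_0 (G (word_index m w)).

Let HE w x : H w (\val x) = G (word_index m w) x.
Proof. exact: valL0E. Qed.

Lemma pderivw_cpderiv w f (x : closure A) : Cmc A m f -> (size w <= m)%N -> A (\val x) ->
  pderivw w ('valL_0 f) (\val x) = cpderiv (word_index m w) f x.
Proof.
move=> fC wm Ax; have [_ ->//] := cpderivP fC (word_index_P_ wm).
rewrite /ipderiv pderiv_word; have [_ gC _] := fC.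
by rewrite (pderivw_perm oA gC wm (perm_index_word wm)) ?inE.
Qed.

(** Uniform convergence of derivatives, applied to [pderivw w] of the approximating functions. *)
Lemma jet_limit_is_derive w j x : (size w < m)%N -> A x ->
  is_derive x (basis_vec R j) (H w) (H (j :: w) x).
Proof.
move=> wm Ax; apply: (@is_derive_uniform_limit _ _ A) => // e /GP[f fC fG].
exists (pderivw w ('valL_0 f)).
  have [_ /Cm_Creg/Creg_wordP/(_ w (ltnW wm))[_ /(_ wm)] df _] := fC.
  by move=> y Ay; exact: df.
move=> y Ay; have [z zy] := closure_sub Ay; rewrite -zy in Ay *.
rewrite !HE; split.
  by rewrite (pderivw_cpderiv fC (ltnW wm) Ay); apply: fG; exact: word_index_P_ (ltnW wm).
rewrite -[X in `|X - _|]/(pderivw (j :: w) ('valL_0 f) (\val z)).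
by rewrite (@pderivw_cpderiv (j :: w) f z fC wm Ay); apply: fG; exact: word_index_P_.
Qed.

Lemma jet_limit_pderivw w : (size w <= m)%N -> {in A, pderivw w (H [::]) =1 H w}.
Proof.
elim: w => [//|j w IHw] wm x xA /=.
rewrite (eq_on_pderiv1 j oA (IHw (ltnW wm)) xA).
exact: (@derive_val _ _ _ _ _ _ _ (jet_limit_is_derive j wm (set_mem xA))).
Qed.

Lemma word_index_nil : word_index m [::] = index0 n m.
Proof. by apply/ffunP => j; rewrite !ffunE; apply: val_inj; rewrite /= inordK. Qed.

(** The components of [G] themselves are the continuous extensions of the derivatives. *)
Lemma jet_limit_Cmc : Cmc A m (G (index0 n m)).
Proof.
apply/(CmcP m oA); split; first exact: jet_limit_continuous (index0_P_ n m).
rewrite -word_index_nil; apply/Creg_wordP => w wm; split.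
  exists (G (word_index m w)); split; first exact/jet_limit_continuous/word_index_P_.
  by move=> x Ax; rewrite jet_limit_pderivw ?inE// HE.
move=> {}wm j x Ax; have Hw y : y \in A -> H w y = pderivw w (H [::]) y.
  by move=> yA; rewrite jet_limit_pderivw// ltnW.
apply: (eq_on_derivable oA Ax Hw).
exact: (@ex_derive _ _ _ _ _ _ _ (jet_limit_is_derive j wm Ax)).
Qed.

Lemma jet_limit_cpderiv p : p \in P_ n m -> cpderiv p (G (index0 n m)) = G p.
Proof.
move=> pm; apply: cpderiv_unique; first exact: jet_limit_continuous.
move=> x Ax; rewrite /ipderiv pderiv_word -word_index_nil.
rewrite inE -size_index_word in pm.
by rewrite [RHS](jet_limit_pderivw pm) ?inE// HE word_indexK.
Qed.

End jets.

(** * The norm of [BCm] and its completeness *)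

Section norm_m.
Variables (R : realType) (n m : nat) (A : set 'rV[R]_n).
Hypotheses (oA : open A) (A0 : A !=set0).
Implicit Types (f g : closure A -> R) (p : {ffun 'I_n -> 'I_m.+1}).

Lemma norm_m_leP f (r : R) : (norm_m A m f <= r%:E)%E <->
  forall p, p \in P_ n m -> forall x, `|cpderiv p f x| <= r.
Proof.
split=> [fr p pm x|fr].
  rewrite -lee_fin; apply: le_trans fr; rewrite /norm_m (bigD1 p)//= le_max.
  by apply/orP; left; apply: ereal_sup_ubound; exists x.
apply/bigmax_leP; split=> [|p pm]; first exact: leNye.
by apply: ge_ereal_sup => _ [x _ <-]; rewrite lee_fin fr.
Qed.

Lemma BCmP f : BCm A m f <-> Cmc A m f /\ exists r : R, (norm_m A m f <= r%:E)%E.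
Proof.
split=> -[fC]; last first.
  by move=> [r /norm_m_leP fr]; split=> // p pm; exists r; split;
    [exact: num_real|move=> M rM x _; exact: le_trans (fr p pm x) (ltW rM)].
move=> fb; split=> //.
have [r rP] : exists r, forall p, p \in P_ n m -> forall x, `|cpderiv p f x| <= r.
  (* There are finitely many multi-indices, so bounds that hold for all large [r] hold
     simultaneously. *)
  suff /pinfty_ex_gt0[r _ rP] : \forall r \near +oo, forall p, p \in P_ n m ->
      forall x, `|cpderiv p f x| <= r by exists r.
  apply: filter_forall => p; have [pm|pm] := boolP (p \in P_ n m).
    have [r [r0 rP]] := fb p pm; exists r; split=> // M rM _ x.
    exact: rP M rM x I.
  exact: nearW.
by exists r; apply/norm_m_leP.
Qed.

(** A point of [A] excludes the value [-oo], which is the supremum over an empty domain. *)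
Lemma norm_m_fin_num f : BCm A m f -> norm_m A m f \is a fin_num.
Proof.
move=> /BCmP[_ [r fr]]; have [a Aa] := A0; have [x _] := closure_sub Aa.
rewrite fin_numElt (le_lt_trans fr) ?ltry// andbT.
apply: lt_le_trans (ltNyr `|cpderiv (index0 n m) f x|) _.
rewrite /norm_m (bigD1 (index0 n m)) ?index0_P_//= le_max.
by apply/orP; left; apply: ereal_sup_ubound; exists x.
Qed.

Lemma BCm_norm_le f (r : R) : BCm A m f -> fine (norm_m A m f) <= r <->
  forall p, p \in P_ n m -> forall x, `|cpderiv p f x| <= r.
Proof.
by move=> fB; rewrite -norm_m_leP -[X in (X <= _)%E]fineK ?lee_fin// norm_m_fin_num.
Qed.

Lemma BCm_cpderiv_le f p x : BCm A m f -> p \in P_ n m ->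
  `|cpderiv p f x| <= fine (norm_m A m f).
Proof. by move=> fB pm; apply: (iffLR (BCm_norm_le _ fB)). Qed.

Lemma cpderiv_0 p : p \in P_ n m -> cpderiv p (0 : closure A -> R) = 0.
Proof.
have := cpderiv_lin oA (- 1) (Cmc0 m oA) (Cmc0 m oA).
by move=> /[apply]; rewrite scaleN1r oppr0 addr0 scaleN1r addNr.
Qed.

Lemma BCm0 : BCm A m 0.
Proof.
apply/BCmP; split; first exact: Cmc0; exists 0; apply/norm_m_leP => p pm x.
by rewrite cpderiv_0// normr0.
Qed.

Lemma BCm_lin_norm (a : R) f g : BCm A m f -> BCm A m g ->
  (norm_m A m (a *: f + g)%R <=
   (`|a| * fine (norm_m A m f) + fine (norm_m A m g))%R%:E)%E.
Proof.
move=> fB gB; apply/norm_m_leP => p pm x.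
rewrite (cpderiv_lin oA a (proj1 fB) (proj1 gB) pm) !fctE.
rewrite (le_trans (ler_normD _ _))// normrZ lerD ?BCm_cpderiv_le//.
by rewrite ler_wpM2l// BCm_cpderiv_le.
Qed.

Lemma BCm_lin (a : R) f g : BCm A m f -> BCm A m g -> BCm A m (a *: f + g).
Proof.
move=> fB gB; apply/BCmP; split.
  by apply: Cmc_lin => //; [case: fB|case: gB].
by exists (`|a| * fine (norm_m A m f) + fine (norm_m A m g)); exact: BCm_lin_norm.
Qed.

Lemma fine_norm_m_lin (a : R) f g : BCm A m f -> BCm A m g ->
  fine (norm_m A m (a *: f + g)) <= `|a| * fine (norm_m A m f) + fine (norm_m A m g).
Proof.
move=> fB gB; rewrite -lee_fin fineK; first exact: BCm_lin_norm.
exact/norm_m_fin_num/BCm_lin.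
Qed.

Lemma fine_norm_m_eq0 f : BCm A m f -> fine (norm_m A m f) = 0 -> f = 0.
Proof.
move=> fB f0; apply/funext => x; apply/eqP; rewrite -normr_le0 -f0.
have [[cf _ _] _] := fB; rewrite -[in X in X <= _](cpderiv0 m cf).
exact: BCm_cpderiv_le (index0_P_ n m).
Qed.

Lemma fine_norm_m_ge0 f : BCm A m f -> 0 <= fine (norm_m A m f).
Proof.
move=> fB; have [a /closure_sub[x _]] := A0.
exact: le_trans (normr_ge0 _) (BCm_cpderiv_le x fB (index0_P_ n m)).
Qed.

Lemma fine_norm_m0 : fine (norm_m A m (0 : closure A -> R)) = 0.
Proof.
apply/eqP; rewrite eq_le fine_norm_m_ge0 ?andbT; last exact: BCm0.
apply/BCm_norm_le => [|p pm x]; first exact: BCm0.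
by rewrite cpderiv_0// normr0.
Qed.

(** The reverse inequality is the upper estimate for the scalar [a^-1] and the function [a *: f]. *)
Lemma fine_norm_mZ (a : R) f : BCm A m f ->
  fine (norm_m A m (a *: f)) = `|a| * fine (norm_m A m f).
Proof.
have le_scale b g : BCm A m g -> fine (norm_m A m (b *: g)) <= `|b| * fine (norm_m A m g).
  by move=> gB; have := fine_norm_m_lin b gB BCm0; rewrite fine_norm_m0 !addr0.
move=> fB; apply/eqP; rewrite eq_le le_scale//=.
have [->|a0] := eqVneq a 0; first by rewrite normr0 mul0r scale0r fine_norm_m0.
have afB : BCm A m (a *: f) by have := BCm_lin a fB BCm0; rewrite addr0.
have := le_scale a^-1 _ afB; rewrite scalerA mulVf// scale1r normfV.
by rewrite ler_pdivlMl ?normr_gt0.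
Qed.

Lemma BCm_complete (u : nat -> closure A -> R) : (forall k, BCm A m (u k)) ->
  (forall e : R, 0 < e -> exists K, forall k l, (K <= k)%N -> (K <= l)%N ->
    fine (norm_m A m (u k - u l)) <= e) ->
  exists2 f, BCm A m f & forall e : R, 0 < e -> exists K, forall k, (K <= k)%N ->
    fine (norm_m A m (f - u k)) <= e.
Proof.
move=> uB uC; have uCm k : Cmc A m (u k) by have [] := uB k.
have subE f g : f - g = - 1 *: g + f by rewrite scaleN1r addrC.
(* All derivatives are put into one function of a multi-index and a point, so that a single uniform
   limit yields the whole jet; the value 0 off [P_ m] keeps the sequence Cauchy there. *)
pose v k (px : {ffun 'I_n -> 'I_m.+1} * closure A) :=
  if px.1 \in P_ n m then cpderiv px.1 (u k) px.2 else 0.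
have [e e0|G' GP] := @uniformly_cauchy_limit R _ v.
  have [K Ke] := uC _ e0; exists K => k l Kk Kl [p x]; rewrite /v /=.
  case: ifPn => pm; last by rewrite subrr normr0 ltW.
  apply: le_trans (Ke _ _ Kk Kl); rewrite subE.
  have := BCm_cpderiv_le x (BCm_lin (- 1) (uB l) (uB k)) pm.
  by rewrite (cpderiv_lin oA _ (uCm l) (uCm k) pm) scaleN1r addrC.
pose G p x := G' (p, x).
have GPm (e : R) : 0 < e -> exists K, forall k, (K <= k)%N -> forall p,
    p \in P_ n m -> forall x, `|cpderiv p (u k) x - G p x| <= e.
  move=> /GP[K Ke]; exists K => k Kk p pm x.
  by have := Ke k Kk (p, x); rewrite /v /= pm.
have jG (e : R) : 0 < e -> exists2 f, Cmc A m f &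
    forall p, p \in P_ n m -> forall x, `|cpderiv p f x - G p x| <= e.
  by move=> /GPm[K Ke]; exists (u K) => //; exact: Ke.
have fC := jet_limit_Cmc oA jG; have fG := jet_limit_cpderiv oA jG.
set f := G _ in fC fG.
have dist (e : R) : 0 < e -> exists K, forall k, (K <= k)%N ->
    forall p, p \in P_ n m -> forall x, `|cpderiv p (f - u k) x| <= e.
  move=> /GPm[K Ke]; exists K => k Kk p pm x.
  rewrite subE (cpderiv_lin oA _ (uCm k) fC pm) scaleN1r addrC fG//.
  by rewrite !fctE distrC; exact: Ke.
(* [f] is the sum of [u K] and a difference of norm at most 1. *)
have fB : BCm A m f.
  have [K Ke] := dist 1 ltr01.
  have dB : BCm A m (f - u K).
    apply/BCmP; split; first by rewrite subE; exact: Cmc_lin.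
    by exists 1; apply/norm_m_leP; exact: Ke.
  by have := BCm_lin 1 dB (uB K); rewrite scale1r subrK.
exists f => // e /dist[K Ke]; exists K => k Kk.
by apply/BCm_norm_le; [rewrite subE; exact: BCm_lin|exact: Ke].
Qed.

(** Serves both for [BCm] itself and for its subspace of functions with limits; closedness of [S] is
    expressed by approximation in norm. *)
Lemma banach_on_norm_m (S : set (closure A -> R)) : S `<=` BCm A m -> S 0 ->
  (forall (a : R) f g, S f -> S g -> S (a *: f + g)) ->
  (forall f, BCm A m f -> (forall e : R, 0 < e ->
    exists2 g, S g & fine (norm_m A m (f - g)) <= e) -> S f) ->
  banach_on S (fine \o norm_m A m).
Proof.
move=> SB S0 Slin Scl; split=> //.
- move=> f g /SB fB /SB gB; have := fine_norm_m_lin 1 fB gB.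
  by rewrite scale1r normr1 mul1r.
- by move=> a f /SB; exact: fine_norm_mZ.
- by move=> f /SB; exact: fine_norm_m_eq0.
- move=> u uS uC; have [f fB uf] := BCm_complete (fun k => SB _ (uS k)) uC.
  exists f => //; apply: Scl => // e /uf[K Ke].
  by exists (u K) => //; exact: Ke.
Qed.
End norm_m.

(** * Inclusions of normed subspaces *)

Section subspace_inclusion.
Variables (R : realType) (V : lmodType R) (S S' : set V) (N : V -> R).
Hypotheses (SN : banach_on S N) (SN' : banach_on S' N) (SS' : S `<=` S').

Definition subspace_inclusion (x : normed_subspace SN) : normed_subspace SN' :=
  Sub (val x) (mem_set (SS' (normed_subspaceP x))).
Local Notation incl := subspace_inclusion.

Lemma subspace_inclusion_linear : linear incl.
Proof. by move=> a x y; exact: val_inj. Qed.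

HB.instance Definition _ := GRing.isLinear.Build R (normed_subspace SN)
  (normed_subspace SN') _ incl subspace_inclusion_linear.

Lemma closed_range_subspace_inclusion :
  (forall v, S' v -> (forall e : R, 0 < e -> exists2 u, S u & N (v - u) <= e) -> S v) ->
  closed (range incl).
Proof.
move=> Scl b clb; suff Sb : S (val b).
  by exists (Sub (val b) (mem_set Sb) : normed_subspace SN) => //; exact: val_inj.
apply: Scl => [|e e0]; first exact: normed_subspaceP.
have [_ [[x _ <-]]] := clb _ (nbhsx_ballx b e e0).
rewrite -ball_normE /= => bx; exists (val x); first exact: normed_subspaceP.
exact: ltW bx.
Qed.

End subspace_inclusion.

(** * Limits at the points of [X] outside the range of [kappa] *)

Section limits_at_the_remainder.
Variables (R : realType) (S X : topologicalType) (kappa : S -> X).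
Hypothesis kappaP : compactification kappa.
Implicit Types (f g : S -> R) (y : X) (z : R).

(** The trace on [S] of the punctured neighborhoods of [y]; it makes [klim] an ordinary limit along
    a filter. *)
Definition remainder_filter y : set_system S :=
  filter_from (nbhs y) (fun U => kappa @^-1` (U `\ y)).

Lemma klimP g y z : klim kappa g y z <-> g @ remainder_filter y --> z.
Proof.
by split=> gz V /gz[U yU] gU; exists U => //; move: gU; rewrite image_subP.
Qed.

(** Density puts points of the range into every neighborhood of [y], and they differ from [y], which
    is not in the range. *)
Lemma remainder_filter_proper y : ~ range kappa y -> ProperFilter (remainder_filter y).
Proof.
move=> yk; apply: filter_from_proper => [|U]; last first.
  rewrite nbhsE => -[W [oW Wy] WU]; have [_ _ kd _] := kappaP.
  have [x [Wx [s _ sx]]] := kd W (ex_intro _ y Wy) oW.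
  exists s; split; first by rewrite /= sx; exact: WU.
  by move=> /= sy; apply: yk; exists s.
apply: filter_from_filter; first by exists setT; exact: filterT.
move=> U W yU yW; exists (U `&` W); first exact: filterI.
by move=> s [[? ?] ?].
Qed.

Lemma klim_lin (a : R) f g y z1 z2 : ~ range kappa y ->
  klim kappa f y z1 -> klim kappa g y z2 -> klim kappa (a *: f + g) y (a *: z1 + z2).
Proof.
move=> yk /klimP fz /klimP gz; apply/klimP; have FF := remainder_filter_proper yk.
by apply: cvgD gz; apply: cvgZ fz; exact: cvg_cst.
Qed.

(** The image of the filter under [g] is Cauchy: the limit of an approximant within [e / 2] is the
    center of a ball of radius [e] belonging to it. *)
Lemma klim_uniform_limit g y : ~ range kappa y ->
  (forall e : R, 0 < e -> exists2 f, (exists z, klim kappa f y z) &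
    forall x, `|g x - f x| <= e) ->
  exists z, klim kappa g y z.
Proof.
move=> yk fg; have FF := remainder_filter_proper yk.
suff /cvg_ex[z gz] : cvg (g @ remainder_filter y) by exists z; exact/klimP.
apply/cauchy_cvgP/cauchy_exP => e e0; have e2 := divr_gt0 e0 (ltr0n R 2).
have [f [z /klimP/cvgrPdist_lt/(_ _ e2) fz] gf] := fg _ e2.
exists z; apply: filterS fz => s fz; rewrite -ball_normE /=.
rewrite [e]splitr (le_lt_trans (ler_distD (f s) _ _))// ltr_leD//.
by rewrite distrC.
Qed.

(* Every point of [X] has a neighborhood on whose preimage [g] is bounded: at a
   point of the image because [kappa] is a homeomorphism onto it, elsewhere
   because [g] has a limit there. *)
Lemma klim_bounded g : continuous g ->
  (forall y, ~ range kappa y -> exists z, klim kappa g y z) ->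
  [bounded g s | s in [set: S]].
Proof.
move=> cg gk; have [/compact_near_coveringP cX _ _ [r [cr rK]]] := kappaP.
(* Compactness in near-covering form: if near every [y] all large [M] are bounds, then all large [M]
   are bounds on the whole of [X]. *)
have bnd (y : X) : [set: X] y -> \forall y' \near y & M \near +oo,
    forall s, kappa s = y' -> `|g s| <= M.
  move=> _; suff [r0 gr] : exists r0 : R, \forall y' \near y,
      forall s, kappa s = y' -> `|g s| <= r0.
    near=> y' M.
    have rM : r0 <= M by near: M; apply: nbhs_pinfty_ge; exact: num_real.
    have gy' s : kappa s = y' -> `|g s| <= r0 by move: s; near: y'; exact: gr.
    by move=> s /gy'/le_trans; exact.
  have [[s _ sy]|yk] := pselect (range kappa y).
    (* The left inverse [r] is continuous along the range, so [g \o r] stays within 1 of [g s] near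
       [y]; at [kappa s'] its value is [g s']. *)
    have ry : r @ within (range kappa) (nbhs y) --> s.
      by rewrite -(rK s) sy; move/subspace_continuousP: cr; apply; exists s.
    have gry : \forall y' \near nbhs y, range kappa y' -> `|g s - g (r y')| <= 1.
      by have /cvgrPdist_le := cvg_comp _ _ ry (cg s); apply.
    exists (`|g s| + 1); apply: filterS gry => y' gy' s' sy'.
    have {gy'} : `|g s - g (r y')| <= 1 by apply: gy'; exists s'.
    rewrite -sy' rK => gs; rewrite -(subrK (g s) (g s')) addrC.
    by rewrite (le_trans (ler_normD _ _))// lerD// distrC.
  have FF := remainder_filter_proper yk.
  have [z /klimP/cvgrPdist_le/(_ 1 ltr01)[U yU gU]] := gk _ yk.
  exists (`|z| + 1); apply: filterS yU => y' Uy' s sy'.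
  have {gU} : `|z - g s| <= 1.
    by apply: gU; rewrite /= sy'; split=> // yy; apply: yk; exists s; rewrite // sy'.
  move=> gs; rewrite -(subrK z (g s)) addrC.
  by rewrite (le_trans (ler_normD _ _))// lerD// distrC.
have [M [Mr MP]] : \forall M \near +oo, [set: X] `<=` fun y =>
    forall s, kappa s = y -> `|g s| <= M.
  exact: (cX R +oo (fun M y => forall s, kappa s = y -> `|g s| <= M)).
by exists M; split=> // M' MM' s _; exact: MP M' MM' (kappa s) I s erefl.
Unshelve. all: by end_near. Qed.

End limits_at_the_remainder.

(** * The weighted space as a multiple of the unweighted one *)

Section weighted_space.
Variables (R : realType) (n m : nat) (A : set 'rV[R]_n) (X : topologicalType)
  (kappa : closure A -> X).
Hypotheses (oA : open A) (A0 : A !=set0) (kappaP : compactification kappa).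
Implicit Types f g phi : closure A -> R.

Definition mulf phi f : closure A -> R := f * phi.

Lemma mulf_linear phi : linear (mulf phi).
Proof. by move=> a f g; apply/funext => x; rewrite /mulf !fctE mulrDl -scalerAl. Qed.

HB.instance Definition _ phi := GRing.isLinear.Build R (closure A -> R)
  (closure A -> R) _ (mulf phi) (mulf_linear phi).

(* the case [phi = 1] of [Cm_kphi] *)
Definition Cm_kappa : set (closure A -> R) :=
  [set f | Cmc A m f /\ forall x : X, ~ range kappa x ->
    forall p, p \in P_ n m -> exists z : R, klim kappa (cpderiv p f) x z].

Lemma Cm_kappa_BCm : Cm_kappa `<=` BCm A m.
Proof.
move=> f [fC fk]; split=> // p pm; apply: (klim_bounded kappaP).
  by have [] := cpderivP fC pm.
by move=> y yk; exact: fk.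
Qed.

Lemma Cm_kappa0 : Cm_kappa 0.
Proof.
split=> [|y yk p pm]; first exact: Cmc0; exists 0; apply/klimP.
have FF := remainder_filter_proper kappaP yk.
by rewrite cpderiv_0//; exact: cvg_cst.
Qed.

Lemma Cm_kappa_lin (a : R) f g : Cm_kappa f -> Cm_kappa g -> Cm_kappa (a *: f + g).
Proof.
move=> [fC fk] [gC gk]; split=> [|y yk p pm]; first exact: Cmc_lin.
have [[z1 fz] [z2 gz]] := (fk y yk p pm, gk y yk p pm).
by exists (a *: z1 + z2); rewrite (cpderiv_lin oA a fC gC pm); exact: klim_lin.
Qed.

(** The norm dominates every [cpderiv p], so each derivative of [f] is a uniform limit of functions
    that have a limit at [y]. *)
Lemma Cm_kappa_closed f : BCm A m f -> (forall e : R, 0 < e ->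
  exists2 g, Cm_kappa g & fine (norm_m A m (f - g)) <= e) -> Cm_kappa f.
Proof.
move=> fB fg; have [fC _] := fB; split=> // y yk p pm.
apply: (klim_uniform_limit kappaP yk) => e /fg[g gk ge].
exists (cpderiv p g) => [|x]; first by case: gk => _; exact.
have [gC _] := gk; have subE : f - g = - 1 *: g + f by rewrite scaleN1r addrC.
have fgB : BCm A m (f - g) by rewrite subE; apply: BCm_lin => //; exact: Cm_kappa_BCm.
have := le_trans (BCm_cpderiv_le A0 x fgB pm) ge.
by rewrite subE (cpderiv_lin oA _ gC fC pm) scaleN1r addrC.
Qed.

Lemma Cm_kphi_mulf phi : Cmc A m phi -> (forall x, 0 < phi x) ->
  Cm_kphi m kappa phi = mulf phi @` Cm_kappa.
Proof.
move=> phiC phi_gt0; have phi0 x : phi x != 0 by rewrite gt_eqF.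
apply/seteqP; split=> [f [fC fk]|_ [g [gC gk] <-]].
  exists (fdiv f phi); last by apply/funext => x; rewrite /mulf /fdiv !fctE divfK.
  by split=> //; exact: (CmcM oA fC (CmcV oA phiC phi0)).
split=> [|y yk p pm]; first exact: CmcM.
have -> : fdiv (mulf phi g) phi = g; last exact: gk.
by apply/funext => x; rewrite /mulf /fdiv !fctE mulfK.
Qed.

End weighted_space.

Theorem theorem3p4 (R : realType) (n m : nat) (n_gt0 : (0 < n)%N)
    (m_gt0 : (0 < m)%N) (A : set 'rV[R]_n) (openA : open A)
    (connectedA : connected A) (unboundedA : ~ bounded_set A)
    (X : metricType R) (compactX : compact [set: X])
    (kappa : closure A -> X) (kappaP : compactification kappa)
    (phi : closure A -> R) (phiC : Cmc A m phi)
    (phi_gt0 : forall x, 0 < phi x) :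
  exists (E : completeNormedModType R) (iota : {linear E -> (closure A -> R)}),
    is_Banach_space_on (Cm_kphi m kappa phi) (norm_kphi m phi) iota /\
    exists (B : completeNormedModType R)
           (iotaB : {linear B -> (closure A -> R)}),
      is_Banach_space_on (BCm A m) (norm_m A m) iotaB /\
      exists T : {linear E -> B},
        (forall f : E, `|T f| = `|f|) /\ closed (range T).
Proof.
(* The empty set is bounded. *)
have A0 : A !=set0.
  apply/set0P/eqP => A_eq0; apply: unboundedA; rewrite A_eq0.
  by exists 0; split=> [|M _ x []]; exact: num_real.
have phi0 x : phi x != 0 by rewrite gt_eqF.
have BB := banach_on_norm_m openA A0 (fun _ => id) (BCm0 m openA)
  (BCm_lin openA A0 (m := m)) (fun f fB _ => fB).
have kB := banach_on_norm_m openA A0 (Cm_kappa_BCm kappaP) (Cm_kappa0 m openA kappaP)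
  (Cm_kappa_lin openA kappaP (m := m)) (Cm_kappa_closed openA A0 kappaP (m := m)).
(* [E] is [Cm_kappa] with the norm of [BCm]. An element [g] stands for the function [g * phi], whose
   weighted norm is the norm of [g]. *)
exists (normed_subspace kB), (mulf phi \o normed_subspace_val (SN := kB)); split.
  have [val_inj' ran nrm] := is_Banach_space_on_normed_subspace kB
    (fun f fk => norm_m_fin_num A0 (Cm_kappa_BCm kappaP fk)).
  have divK g : fdiv (mulf phi g) phi = g.
    by apply/funext => x; rewrite /mulf /fdiv !fctE mulfK.
  split.
  - by move=> f g /(congr1 (fun h => fdiv h phi)); rewrite /= !divK => /val_inj'.
  - rewrite Cm_kphi_mulf//; apply/seteqP; split=> [_ [f _ <-]|_ [g gk <-]].
      by exists (normed_subspace_val f) => //; exact: normed_subspaceP.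
    have [f _ <-] : range (normed_subspace_val (SN := kB)) g by rewrite ran.
    by exists f.
  - by move=> f; rewrite /norm_kphi /= divK nrm.
exists (normed_subspace BB), (normed_subspace_val (SN := BB)); split.
  exact: is_Banach_space_on_normed_subspace (norm_m_fin_num A0 (m := m)).
(* In terms of the functions represented, this inclusion is division by [phi]; both norms are
   computed by [norm_m], so it is isometric by definition. *)
exists (subspace_inclusion (SN := kB) BB (Cm_kappa_BCm kappaP (m := m))); split=> //.
exact/closed_range_subspace_inclusion/Cm_kappa_closed.
Qed.
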